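(* Let $X$ and $Y$ be nonempty metric spaces. The product $X\times Y$ is ULC if and only if both $X$ and $Y$ are ULC.
   Context: A metric space $X$ is uniformly locally connected (ULC) if for every $\varepsilon>0$ there is $\delta>0$ such that any two points of $X$ at distance $<\delta$ lie in a connected subset of $X$ of diameter $<\varepsilon$. The product $X\times Y$ carries the metric $d((x,y),(x',y'))=d_X(x,x')+d_Y(y,y')$. *)

(* Defs.v *)
From HB Require Import structures.
From mathcomp Require Import all_boot all_order all_algebra.
From mathcomp Require Import all_classical all_reals all_analysis.

Set Implicit Arguments.
Unset Strict Implicit.
Unset Printing Implicit Defensive.

Import Order.TTheory GRing.Theory Num.Theory.

Local Open Scope classical_set_scope.
Local Open Scope ring_scope.

(* With this definition the diameter of the empty set is -oo. *)
Definition diameter (R : realType) (X : metricType R) (A : set X) : \bar R :=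
  ereal_sup [set (mdist p.1 p.2)%:E | p in A `*` A].

Definition ULC (R : realType) (X : metricType R) : Prop :=
  forall e : R, 0 < e -> exists2 d : R, 0 < d &
    forall x y : X, mdist x y < d ->
      exists A : set X,
        [/\ A x, A y, connected A & (diameter A < e%:E)%E].

(* The library puts the sup pseudometric on [X * Y]; this alias carries the
   sum metric instead, and the topology (hence connectedness) it induces. *)
Definition sum_prod (R : realType) (X Y : metricType R) : Type := (X * Y)%type.

Section SumProd.
Context (R : realType) (X Y : metricType R).

HB.instance Definition _ := Choice.copy (sum_prod X Y) (X * Y)%type.

Definition sum_mdist (p q : sum_prod X Y) : R :=
  mdist p.1 q.1 + mdist p.2 q.2.

Lemma sum_mdistxx p : sum_mdist p p = 0.
Proof. by rewrite /sum_mdist !mdistxx addr0. Qed.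

Lemma sum_mdist_positivity p q : sum_mdist p q = 0 -> p = q.
Proof.
case: p q => [x y] [x' y'] /eqP.
rewrite /sum_mdist/= paddr_eq0 ?mdist_ge0// => /andP[/eqP xx' /eqP yy'].
by rewrite (mdist_positivity _ _ xx') (mdist_positivity _ _ yy').
Qed.

Lemma sum_mdist_sym p q : sum_mdist p q = sum_mdist q p.
Proof. by congr (_ + _); exact: metric_sym. Qed.

Lemma sum_mdist_triangle q p r :
  sum_mdist p r <= sum_mdist p q + sum_mdist q r.
Proof. by rewrite /sum_mdist addrACA lerD// metric_triangle. Qed.

HB.instance Definition _ := isMetric.Build R (sum_prod X Y)
  sum_mdistxx sum_mdist_positivity sum_mdist_sym sum_mdist_triangle.

Lemma mdist_sum_prodE (p q : sum_prod X Y) :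
  mdist p q = mdist p.1 q.1 + mdist p.2 q.2.
Proof. by []. Qed.

End SumProd.

(* Main.v *)
Require Import Defs.
From mathcomp Require Import all_boot all_order all_algebra.
From mathcomp Require Import all_classical all_reals all_analysis.

(** Both implications transport connected sets along nonexpansive maps, which
    are continuous and do not increase diameters.

    If [X * Y] is ULC, then so is each factor, because it is a nonexpansive
    retract of the product: a point [y0] of [Y] gives the isometric section
    [x |-> (x, y0)] of the first projection, so close points of [X] can be
    joined inside the product and the joining set projected back
    ([ULC_retract]). This is where nonemptiness enters.

    Conversely, two close points of [X * Y] have close coordinates, which are
    joined by connected sets [A] and [B] of diameter less than [e / 2]. The
    product [A * B] then joins the points; its diameter for the sum metric is
    at most the sum of the diameters ([diameter_sum_prod]), and it is connected
    ([connected_sum_prod]). *)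

Import Order.TTheory GRing.Theory Num.Theory.
Local Open Scope classical_set_scope.
Local Open Scope ring_scope.

Definition nonexpansive {R : realType} {X Y : metricType R}
    (f : X -> Y) :=
  forall x x' : X, mdist (f x) (f x') <= mdist x x'.

Lemma nonexpansive_continuous (R : realType) (X Y : metricType R)
    (f : X -> Y) :
  nonexpansive f -> continuous f.
Proof.
move=> f_ne x; apply/cvg_ballP => e e_gt0.
near=> x'; rewrite ballEmdist/=; apply: le_lt_trans (f_ne _ _) _.
have : ball x e x' by near: x'; exact: nbhsx_ballx.
by rewrite ballEmdist.
Unshelve. all: by end_near. Qed.

Lemma nonexpansive_connected (R : realType) (X Y : metricType R)
    (f : X -> Y) (A : set X) :
  nonexpansive f -> connected A -> connected (f @` A).
Proof.
move=> f_ne A_conn; apply: connected_continuous_connected => //.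
exact/continuous_subspaceT/nonexpansive_continuous.
Qed.

Lemma mdist_le_diameter (R : realType) (X : metricType R) (A : set X)
    (x y : X) :
  A x -> A y -> ((mdist x y)%:E <= diameter A)%E.
Proof. by move=> Ax Ay; apply: ereal_sup_ubound; exists (x, y). Qed.

Lemma diameter_le (R : realType) (X : metricType R) (A : set X)
    (r : \bar R) :
  (forall x y, A x -> A y -> (mdist x y)%:E <= r)%E -> (diameter A <= r)%E.
Proof.
by move=> Ar; apply: ge_ereal_sup => _ [[x y] [Ax Ay] <-]; exact: Ar.
Qed.

Lemma nonexpansive_diameter (R : realType) (X Y : metricType R)
    (f : X -> Y) (A : set X) :
  nonexpansive f -> (diameter (f @` A) <= diameter A)%E.
Proof.
move=> f_ne; apply: diameter_le => _ _ [x Ax <-] [y Ay <-].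
apply: (@le_trans _ _ (mdist x y)%:E); first by rewrite lee_fin.
exact: mdist_le_diameter.
Qed.

(** The section carries close points of [Y] to close points of [X], and [f]
    carries a small connected set joining them back to [Y]. *)
Lemma ULC_retract (R : realType) (X Y : metricType R)
    (f : X -> Y) (g : Y -> X) :
  nonexpansive f -> nonexpansive g -> cancel g f -> ULC X -> ULC Y.
Proof.
move=> f_ne g_ne gK X_ulc e e_gt0.
have [d d_gt0 join] := X_ulc e e_gt0; exists d => // x y xy_lt.
have [A [Agx Agy A_conn A_lt]] := join _ _ (le_lt_trans (g_ne x y) xy_lt).
exists (f @` A); split.
- by exists (g x).
- by exists (g y).
- exact: nonexpansive_connected.
- exact: le_lt_trans (nonexpansive_diameter _ _ _ _ _ f_ne) A_lt.
Qed.

Section SumProd.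
Context (R : realType) (X Y : metricType R).

Lemma nonexpansive_fst : nonexpansive (fst : sum_prod X Y -> X).
Proof. by move=> p q; rewrite mdist_sum_prodE lerDl mdist_ge0. Qed.

Lemma nonexpansive_snd : nonexpansive (snd : sum_prod X Y -> Y).
Proof. by move=> p q; rewrite mdist_sum_prodE lerDr mdist_ge0. Qed.

Lemma nonexpansive_pairr (y : Y) :
  nonexpansive (fun x => (x, y) : sum_prod X Y).
Proof. by move=> x x'; rewrite mdist_sum_prodE/= mdistxx addr0. Qed.

Lemma nonexpansive_pairl (x : X) :
  nonexpansive (fun y => (x, y) : sum_prod X Y).
Proof. by move=> y y'; rewrite mdist_sum_prodE/= mdistxx add0r. Qed.

Lemma diameter_sum_prod (A : set X) (B : set Y) :
  (diameter (A `*` B : set (sum_prod X Y)) <= diameter A + diameter B)%E.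
Proof.
apply: diameter_le => -[x y] [x' y'] [/= Ax By] [/= Ax' By'].
by rewrite mdist_sum_prodE EFinD leeD// mdist_le_diameter.
Qed.

(** The product is a union of crosses, one for each [a] in [A]: the vertical
    slice over [a] and the horizontal slice at height [b0]. A cross is
    connected since its two slices meet at [(a, b0)], and all the crosses share
    the horizontal slice. *)
Lemma connected_sum_prod (A : set X) (B : set Y) :
  connected A -> connected B -> connected (A `*` B : set (sum_prod X Y)).
Proof.
move=> A_conn B_conn.
have [[[a0 b0] [/= Aa0 Bb0]]|/nonemptyPn AB0] :=
  pselect ((A `*` B) !=set0); last by rewrite AB0; exact: connected0.
pose cross (a : X) : set (sum_prod X Y) :=
  ((fun y => (a, y)) @` B) `|` ((fun x => (x, b0)) @` A).
have -> : (A `*` B : set (sum_prod X Y)) = \bigcup_(a in A) cross a.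
  apply/seteqP; split=> [[a b] [/= Aa Bb]|_ [a Aa [[b Bb <-]|[x Ax <-]]]] //.
  by exists a => //; left; exists b.
apply: bigcup_connected => [|a Aa].
  by exists (a0, b0) => a Aa; right; exists a0.
apply: connectedU.
- by exists (a, b0); split; [exists b0|exists a].
- exact: nonexpansive_connected (nonexpansive_pairl a) B_conn.
- exact: nonexpansive_connected (nonexpansive_pairr b0) A_conn.
Qed.

Lemma ULC_sum_prod : ULC X -> ULC Y -> ULC (sum_prod X Y).
Proof.
move=> X_ulc Y_ulc e e_gt0.
have e2_gt0 : 0 < e / 2 by rewrite divr_gt0.
have [d1 d1_gt0 joinX] := X_ulc _ e2_gt0.
have [d2 d2_gt0 joinY] := Y_ulc _ e2_gt0.
exists (Num.min d1 d2); first by rewrite lt_min d1_gt0.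
move=> p q; rewrite lt_min => /andP[pq_lt1 pq_lt2].
have [A [Ap Aq A_conn A_lt]] :=
  joinX _ _ (le_lt_trans (nonexpansive_fst p q) pq_lt1).
have [B [Bp Bq B_conn B_lt]] :=
  joinY _ _ (le_lt_trans (nonexpansive_snd p q) pq_lt2).
exists (A `*` B : set (sum_prod X Y)); split => //.
  exact: connected_sum_prod.
apply: le_lt_trans (diameter_sum_prod A B) _.
by rewrite [e]splitr EFinD lteD.
Qed.

End SumProd.

Theorem lemma3p8 (R : realType) (X Y : metricType R)
    (X_neq0 : [set: X] !=set0) (Y_neq0 : [set: Y] !=set0) :
  ULC (sum_prod X Y) <-> ULC X /\ ULC Y.
Proof.
have [x0 _] := X_neq0; have [y0 _] := Y_neq0.
split=> [XY_ulc|[X_ulc Y_ulc]]; last exact: ULC_sum_prod.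
split.
- apply: ULC_retract (nonexpansive_fst _ X Y) (nonexpansive_pairr _ X Y y0) _
    XY_ulc.
  by [].
- apply: ULC_retract (nonexpansive_snd _ X Y) (nonexpansive_pairl _ X Y x0) _
    XY_ulc.
  by [].
Qed.
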